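(* Let $G=(V_1\cup V_2,E)$ be a bipartite $r$-regular graph with $r\ge1$, set $n:=|V_1|=|V_2|\ge 2$, and let $\lambda_2$ be the second largest eigenvalue (counted with multiplicity) of the adjacency matrix $A_G$ of $G$. Then $$g_1(G)\ \le\ \widehat g(G):=\begin{cases}\dfrac{n^2\lambda_2^2}{(\lambda_2+r)^2}&\text{if } r\le 3\lambda_2,\\[2mm] \dfrac{n^2\lambda_2}{8(r-\lambda_2)}&\text{otherwise,}\end{cases}\qquad\text{and}\qquad h_1(G)\ \le\ \widehat h(G):=\frac{n\lambda_2}{2(\lambda_2+r)}.$$ Moreover, $g_1(G)=\widehat g(G)$ if $G$ is vertex-transitive and edge-transitive, and $h_1(G)=\widehat h(G)$ if $G$ is edge-transitive.
   Context: Graphs are finite and simple. For a bipartite graph $G=(V=V_1\cup V_2,E)$, let $\mathcal S^{|V|}$ be the set of real symmetric matrices indexed by $V$, $\langle X,Y\rangle=\mathrm{Tr}(XY)$, $\mathrm{diag}(X)$ the vector of diagonal entries of $X$, and $C=\frac12\begin{pmatrix}0&J\\ J^{T}&0\end{pmatrix}\in\mathcal S^{|V|}$ with respect to $V=V_1\cup V_2$, where $J$ is the $|V_1|\times|V_2|$ all-ones matrix. Define $$g_1(G)=\max_{X\in\mathcal S^{|V|}}\Big\{\langle C,X\rangle:\ \begin{pmatrix}1&\mathrm{diag}(X)^T\\ \mathrm{diag}(X)&X\end{pmatrix}\succeq0,\ X_{ij}=0\text{ for }\{i,j\}\in E\Big\},$$ $$h_1(G)=\max_{X\in\mathcal S^{|V|}}\Big\{\langle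 C,X\rangle:\ X\succeq0,\ \mathrm{Tr}(X)=1,\ X_{ij}=0\text{ for }\{i,j\}\in E\Big\}.$$ $G$ is vertex-transitive (edge-transitive) if its automorphism group acts transitively on its vertices (edges). *)

(* Defs.v *)
From HB Require Import structures.
From mathcomp Require Import all_boot all_order all_algebra all_fingroup.
From mathcomp Require Import ring lra complex.
From mathcomp Require Import all_classical all_reals all_analysis.

Set Implicit Arguments.
Unset Strict Implicit.
Unset Printing Implicit Defensive.

Import Order.TTheory GRing.Theory Num.Theory.
Import numFieldNormedType.Exports.

Local Open Scope ring_scope.

Section Graphs.
Variables (T : finType) (e : rel T).

Definition cross (V1 V2 : {set T}) (x y : T) : bool :=
  (x \in V1) && (y \in V2) || (x \in V2) && (y \in V1).

Definition bipartition (V1 V2 : {set T}) : Prop :=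
  [/\ V1 :|: V2 = [set: T]%SET, [disjoint V1 & V2] &
      forall x y, e x y -> cross V1 V2 x y].

Definition regular (r : nat) : Prop := forall x, #|[set y | e x y]%SET| = r.

Definition edges : {set {set T}} :=
  [set [set p.1; p.2] | p : T * T & e p.1 p.2]%SET.

Definition automorphisms : {set {perm T}} :=
  [set s : {perm T} | [forall x, forall y, e (s x) (s y) == e x y]]%SET.

Lemma automorphisms_group_set : group_set automorphisms.
Proof.
apply/group_setP; split.
  by rewrite inE; apply/forallP => x; apply/forallP => y; rewrite !perm1.
move=> s t; rewrite !inE => /'forall_'forall_eqP es /'forall_'forall_eqP et.
by apply/'forall_'forall_eqP => x y; rewrite !permM et es.
Qed.
Canonical automorphisms_group := Group automorphisms_group_set.

Definition vertex_transitive : bool :=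
  [transitive automorphisms, on [set: T]%SET | 'P].

Definition edge_transitive : bool :=
  [transitive automorphisms, on edges | 'P^*].

End Graphs.

Section Spectrum.
Variable R : realType.

(* The eigenvalues of A, repeated according to multiplicity, in nonincreasing
   order: by eigenvaluesP this sequence exists when A is symmetric. *)
Definition eigenvalues N (A : 'M[R]_N) : seq R :=
  xget [::] [set s : seq R |
    sorted >=%R s /\ char_poly A = \prod_(x <- s) ('X - x%:P)]%classic.

Definition lambda2 N (A : 'M[R]_N) : R := (eigenvalues A)`_1.

Lemma char_poly_conj (K : fieldType) N (P D : 'M[K]_N) : P \in unitmx ->
  char_poly (invmx P *m D *m P) = char_poly D.
Proof.
move=> Pu; pose c := map_mx (@polyC K).
have cu : c _ _ (invmx P) *m c _ _ P = 1%:M.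
  by rewrite -map_mxM mulVmx // map_mx1.
rewrite /char_poly /char_poly_mx !map_mxM /=.
have -> : 'X%:M - c _ _ (invmx P) *m c _ _ D *m c _ _ P =
    c _ _ (invmx P) *m ('X%:M - c _ _ D) *m c _ _ P.
  by rewrite mulmxBr mulmxBl scalar_mxC -(mulmxA 'X%:M) cu mulmx1.
by rewrite !det_mulmx mulrAC -det_mulmx cu det1 mul1r.
Qed.

Lemma char_poly_sym_split N (A : 'M[R]_N) : A^T = A ->
  exists s : seq R, char_poly A = \prod_(x <- s) ('X - x%:P).
Proof.
move=> Asym; pose f : {rmorphism R -> complex.complex R} := complex.real_complex R.
pose B := map_mx f A.
have Bherm : B \is hermsymmx.
  apply/is_hermitianmxP; rewrite expr0 scale1r.
  apply/matrixP => i j; rewrite !mxE -[A in LHS]Asym mxE.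
  by apply: esym; exact: complex.conjc_real.
have dreal := hermitian_spectral_diag_real Bherm.
exists [seq complex.Re (spectral_diag B 0 i) | i <- enum 'I_N].
apply: (@map_poly_inj _ _ f).
rewrite map_char_poly -/B rmorph_prod big_map big_enum /=.
have /orthomx_spectralP Beq := hermitian_normalmx Bherm; rewrite [in LHS]Beq.
rewrite char_poly_conj ?spectral_unit // char_poly_trig ?diag_mx_is_trig //.
apply: eq_bigr => i _; rewrite mxE eqxx mulr1n.
rewrite rmorphB /= map_polyX map_polyC /=.
by congr ('X - _%:P); apply: esym; apply: complex.RRe_real; exact: (mxOverP dreal).
Qed.

Lemma eigenvaluesP N (A : 'M[R]_N) : A^T = A ->
  sorted >=%R (eigenvalues A) /\
  char_poly A = \prod_(x <- eigenvalues A) ('X - x%:P).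
Proof.
move=> /char_poly_sym_split [s As].
have sP : [set s : seq R | sorted >=%R s /\
    char_poly A = \prod_(x <- s) ('X - x%:P)]%classic (sort >=%R s).
  split; first by apply: sort_sorted => x y; exact: le_total.
  by rewrite As; apply: perm_big; rewrite perm_sym perm_sort.
exact: (xgetPex [::] (ex_intro _ _ sP)).
Qed.

End Spectrum.

Section SemidefinitePrograms.
Variable R : realType.

Definition psd N (X : 'M[R]_N) : Prop :=
  X^T = X /\ forall v : 'rV[R]_N, 0 <= (v *m X *m v^T) 0 0.

Definition inner_mx N (X Y : 'M[R]_N) : R := \tr (X *m Y).

Definition bordered N (X : 'M[R]_N) : 'M[R]_(1 + N) :=
  let d := \col_i X i i in block_mx 1%:M d^T d X.

(* g1_attained and h1_attained show that for the two programs below this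
   supremum is a maximum. *)
Definition sdp_max N (C : 'M[R]_N) (F : set 'M[R]_N) : R :=
  sup [set inner_mx C X | X in F]%classic.

End SemidefinitePrograms.

Section Bounds.
Variables (R : realType) (T : finType).

(* Matrices indexed by V are indexed by 'I_#|V| through enum_val. *)
Definition adjacency (e : rel T) : 'M[R]_#|T| :=
  \matrix_(i, j) (e (enum_val i) (enum_val j))%:R.

Definition objective (V1 V2 : {set T}) : 'M[R]_#|T| :=
  \matrix_(i, j) (2^-1 * (cross V1 V2 (enum_val i) (enum_val j))%:R).

Definition zero_on_edges (e : rel T) (X : 'M[R]_#|T|) : Prop :=
  forall i j, e (enum_val i) (enum_val j) -> X i j = 0.

Definition g1_feasible (e : rel T) : set 'M[R]_#|T| :=
  [set X | psd (bordered X) /\ zero_on_edges e X]%classic.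

Definition h1_feasible (e : rel T) : set 'M[R]_#|T| :=
  [set X | [/\ psd X, \tr X = 1 & zero_on_edges e X]]%classic.

Definition g1 (e : rel T) (V1 V2 : {set T}) : R :=
  sdp_max (objective V1 V2) (g1_feasible e).

Definition h1 (e : rel T) (V1 V2 : {set T}) : R :=
  sdp_max (objective V1 V2) (h1_feasible e).

End Bounds.

Definition ghat (R : realType) (n r : nat) (l : R) : R :=
  if r%:R <= 3 * l then n%:R ^+ 2 * l ^+ 2 / (l + r%:R) ^+ 2
  else n%:R ^+ 2 * l / (8 * (r%:R - l)).

Definition hhat (R : realType) (n r : nat) (l : R) : R :=
  n%:R * l / (2 * (l + r%:R)).

Section Attainment.
Variable R : realType.
Local Open Scope classical_set_scope.

Lemma psd_ge_abs N (X : 'M[R]_N) i j : psd X ->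
  2 * `|X i j| <= X i i + X j j.
Proof.
move=> [Xs Xp].
have Q (a b : R) : 0 <= a ^+ 2 * X i i + 2 * (a * b) * X i j + b ^+ 2 * X j j.
  have := Xp (a *: delta_mx 0 i + b *: delta_mx 0 j).
  have E k l : ((delta_mx 0 k *m X *m delta_mx l 0) : 'M[R]_1) 0 0 = X k l.
    by rewrite -rowE -colE !mxE.
  rewrite [(_ + _)^T]linearD /= ![(_ *: _)^T]linearZ /= !trmx_delta.
  rewrite !mulmxDl !mulmxDr -!scalemxAl -!scalemxAr.
  have -> (M1 M2 M3 M4 : 'M[R]_1) :
      (M1 + M2 + (M3 + M4)) 0 0 = M1 0 0 + M2 0 0 + (M3 0 0 + M4 0 0).
    by rewrite !mxE.
  have Z k (M : 'M[R]_1) : (k *: M) 0 0 = k * M 0 0 by rewrite mxE.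
  rewrite !Z !E.
  have -> : X j i = X i j by rewrite -[in LHS]Xs mxE.
  by congr (_ <= _); ring.
have := Q 1 1; have := Q 1 (-1).
by case: (ltrgt0P (X i j)) => *; lra.
Qed.

Lemma closed_ge0 (U : topologicalType) (f : U -> R) : continuous f ->
  closed [set v | 0 <= f v].
Proof. by move=> cf; apply: (preimage_closed _ (@closed_ge _ 0)) => x _; apply: cf. Qed.

Lemma closed_eqc (U : topologicalType) (f : U -> R) (a : R) : continuous f ->
  closed [set v | f v = a].
Proof. by move=> cf; apply: (preimage_closed _ (@closed_eq _ a)) => x _; apply: cf. Qed.

Lemma closed_forall (U : topologicalType) I (P : I -> U -> Prop) :
  (forall i, closed [set v | P i v]) -> closed [set v | forall i, P i v].
Proof.
move=> cP; have -> : [set v | forall i, P i v] = \bigcap_i [set v | P i v].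
  by apply/seteqP; split => v /= h i; [move=> _; exact: h | exact: h].
by apply: closed_bigI => i _; exact: cP.
Qed.

Lemma sum_continuous (U : topologicalType) (I : finType) (f : I -> U -> R) :
  (forall i, continuous (f i)) -> continuous (fun v => \sum_i f i v).
Proof.
move=> cf v; apply: (@cvg_big R^o) => [|i _]; [exact: add_continuous|exact: cf].
Qed.

Lemma closed_psd (U : topologicalType) N (Y : U -> 'M[R]_N) :
  (forall i j, continuous (fun v => Y v i j)) -> closed [set v | psd (Y v)].
Proof.
move=> cY; apply: closedI.
  have -> : (fun v => (Y v)^T = Y v) =
      (fun v => forall i j, Y v j i - Y v i j = 0).
    apply/funext => v; apply/propext; split => [h i j|h].
      by rewrite -[in X in X - _]h mxE subrr.
    by apply/matrixP => i j; rewrite mxE; apply/eqP; rewrite -subr_eq0 h.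
  apply: closed_forall => i; apply: closed_forall => j; apply: closed_eqc => v.
  by apply: (@continuousB _ R^o); exact: cY.
apply: closed_forall => w; apply: closed_ge0.
under eq_fun do rewrite mxE.
apply: sum_continuous => j v.
under eq_fun do rewrite !mxE.
apply: continuousM; last exact: cst_continuous.
apply: sum_continuous => i {}v.
by apply: continuousM; [exact: cst_continuous | exact: cY].
Qed.

Lemma vec_mx_continuous N i j :
  continuous (fun v : 'rV[R]_(N * N) => (vec_mx v : 'M[R]_N) i j).
Proof. by under eq_fun do rewrite mxE; exact: coord_continuous. Qed.

Lemma sdp_attained N (C : 'M[R]_N) (F : set 'M[R]_N) :
    F !=set0 -> (forall X, F X -> forall i j, `|X i j| <= 1) ->
    closed [set v : 'rV[R]_(N * N) | F (vec_mx v)] ->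
  exists2 X, F X & inner_mx C X = sdp_max C F /\
    forall Y, F Y -> inner_mx C Y <= sdp_max C F.
Proof.
move=> [X0 FX0] Fb Fc.
have Fk : compact [set v : 'rV[R]_(N * N) | F (vec_mx v)].
  have K : compact [set v : 'rV[R]_(N * N) | forall i, `[(- 1 : R), 1] (v ord0 i)].
    by apply: (@rV_compact _ _ (fun=> `[(- 1 : R), 1])) => _; exact: segment_compact.
  apply: subclosed_compact Fc K _ => v /= Fv k.
  case/mxvec_indexP: k => i j; have := Fb _ Fv i j.
  by rewrite mxE in_itv /= ler_norml.
have cC : continuous (fun v : 'rV[R]_(N * N) => inner_mx C (vec_mx v)).
  apply: sum_continuous => i v; under eq_fun do rewrite mxE.
  apply: sum_continuous => j {}v.
  by apply: continuousM; [exact: cst_continuous | exact: vec_mx_continuous].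
have F0 : [set v : 'rV[R]_(N * N) | F (vec_mx v)] !=set0.
  by exists (mxvec X0); rewrite /= mxvecK.
have [v Fv vmax] := EVT_max_rV F0 Fk (continuous_subspaceT cC).
have {}vmax Y : F Y -> inner_mx C Y <= inner_mx C (vec_mx v).
  by move=> FY; have := vmax (mxvec Y); rewrite mxvecK; apply; rewrite inE /= mxvecK.
rewrite inE /= in Fv.
have E : inner_mx C (vec_mx v) = sdp_max C F.
  apply/eqP; rewrite eq_le; apply/andP; split.
    apply: ub_le_sup; last by exists (vec_mx v).
    by exists (inner_mx C (vec_mx v)) => _ [Y FY <-]; exact: vmax.
  apply: ge_sup; first by exists (inner_mx C X0); exists X0.
  by move=> _ [Y FY <-]; exact: vmax.
by exists (vec_mx v) => //; rewrite -E.
Qed.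

Lemma closed_zero_on_edges (U : topologicalType) (T : finType) (e : rel T)
    (Y : U -> 'M[R]_#|T|) :
  (forall i j, continuous (fun v => Y v i j)) ->
  closed [set v | zero_on_edges e (Y v)].
Proof.
move=> cY; apply: closed_forall => i; apply: closed_forall => j.
by apply: closed_forall => _; exact: closed_eqc.
Qed.

Lemma psd0 N : psd (0 : 'M[R]_N).
Proof. by split=> [|v]; rewrite ?trmx0 // mulmx0 mul0mx mxE. Qed.

Lemma psd_sqr N (w : 'rV[R]_N) : psd (w^T *m w).
Proof.
split=> [|v]; first by rewrite trmx_mul trmxK.
have -> : v *m (w^T *m w) *m v^T = (v *m w^T) *m (v *m w^T)^T.
  by rewrite trmx_mul trmxK !mulmxA.
by move: (v *m w^T) => u; rewrite mxE big_ord1 mxE -expr2 sqr_ge0.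
Qed.

Lemma bordered0 N :
  bordered (0 : 'M[R]_N) = (delta_mx 0 0 : 'rV_(1 + N))^T *m delta_mx 0 0.
Proof.
apply/matrixP => i j; rewrite /bordered [RHS]mxE big_ord1.
by case: (split_ordP i) => a ->; case: (split_ordP j) => b ->;
  rewrite ?(block_mxEul, block_mxEur, block_mxEdl, block_mxEdr) !mxE
    -?val_eqE /= ?ord1 ?mulr1 ?mulr0 ?mul0r.
Qed.

Lemma g1_attained (T : finType) (e : rel T) (V1 V2 : {set T}) :
  exists2 X : 'M[R]_#|T|, g1_feasible e X &
    inner_mx (objective R V1 V2) X = g1 R e V1 V2 /\
    forall Y, g1_feasible e Y -> inner_mx (objective R V1 V2) Y <= g1 R e V1 V2.
Proof.
apply: sdp_attained.
- exists 0; split; first by rewrite bordered0; exact: psd_sqr.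
  by move=> i j _; rewrite mxE.
- move=> X [pX _] i j.
  have D k : X k k <= 1.
    have := psd_ge_abs (lshift _ 0) (rshift _ k) pX.
    rewrite /bordered block_mxEul block_mxEur block_mxEdr !mxE eqxx mulr1n => h.
    by have := ler_norm (X k k); lra.
  have := psd_ge_abs (rshift 1 i) (rshift 1 j) pX.
  rewrite /bordered !block_mxEdr => h.
  by have := D i; have := D j; lra.
- have cX := @vec_mx_continuous #|T|.
  apply: closedI; last exact: closed_zero_on_edges.
  apply: closed_psd => i j; rewrite /bordered.
  case: (split_ordP i) => a ->; case: (split_ordP j) => b ->.
  + under eq_fun do rewrite block_mxEul; exact: cst_continuous.
  + under eq_fun do rewrite block_mxEur 2!mxE; exact: cX.
  + under eq_fun do rewrite block_mxEdl mxE; exact: cX.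
  + under eq_fun do rewrite block_mxEdr; exact: cX.
Qed.

Lemma h1_attained (T : finType) (e : rel T) (V1 V2 : {set T}) :
    irreflexive e -> (0 < #|T|)%N ->
  exists2 X : 'M[R]_#|T|, h1_feasible e X &
    inner_mx (objective R V1 V2) X = h1 R e V1 V2 /\
    forall Y, h1_feasible e Y -> inner_mx (objective R V1 V2) Y <= h1 R e V1 V2.
Proof.
move=> eirr T0; apply: sdp_attained.
- pose k := Ordinal T0; pose w : 'rV[R]_#|T| := delta_mx 0 k.
  have wE i j : (w^T *m w) i j = ((i == k) && (j == k))%:R.
    by rewrite mxE big_ord1 !mxE eqxx /= -natrM mulnb.
  exists (w^T *m w); split; first exact: psd_sqr.
    rewrite /mxtrace (bigD1 k) //= wE eqxx big1 ?addr0 // => i /negPf ik.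
    by rewrite wE ik.
  move=> i j; rewrite wE; case: eqP => [->|//]; case: eqP => [->|//].
  by rewrite eirr.
- move=> X [pX trX _] i j.
  have D0 k : 0 <= X k k.
    by have := psd_ge_abs k k pX; have := normr_ge0 (X k k); lra.
  have D k : X k k <= 1.
    rewrite -trX /mxtrace (bigD1 k) //= lerDl.
    by apply: sumr_ge0 => l _; exact: D0.
  by have := psd_ge_abs i j pX; have := D i; have := D j; lra.
- have cX := @vec_mx_continuous #|T|.
  have -> : [set v : 'rV[R]_(#|T| * #|T|) | h1_feasible e (vec_mx v)] =
      [set v | psd (vec_mx v)] `&` ([set v | \tr (vec_mx v : 'M[R]_#|T|) = 1] `&`
      [set v | zero_on_edges e (vec_mx v)]).
    by apply/seteqP; split => v /= [] // ? [].
  apply: closedI; first exact: closed_psd.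
  apply: closedI; last exact: closed_zero_on_edges.
  by apply: closed_eqc; apply: sum_continuous => i; exact: cX.
Qed.

End Attainment.

(* Main.v *)
Require Import Defs.
From mathcomp Require Import all_boot all_order all_algebra all_fingroup.
From mathcomp Require Import ring lra.
From mathcomp Require Import all_classical all_reals all_analysis.

(** Everything lives in the space of vectors indexed by the 2n vertices, where
    one is the all-ones vector and sgn is the vector equal to 1 on V1 and to -1
    on V2.  Write J and S for the rank-one matrices of one and sgn.  The
    objective is (J - S) / 4, regularity says that one is an eigenvector of A
    for r, and bipartiteness says that conjugation by the diagonal matrix of
    sgn turns A into -A.

    Upper bounds.  Subtracting from A its top eigenvector leaves a matrix with
    largest eigenvalue lambda2 ([deflation_psd]); flipping signs and projecting
    away one shows that
      lambda2 I + A - (r + lambda2) / 2n J + (r - lambda2) / 2n S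
    is positive semidefinite ([dual_psd]).  Its inner product with a feasible X
    is therefore nonnegative; as X vanishes on edges, A disappears and one
    linear inequality remains between the trace of X and the values j and s of
    its quadratic form at one and sgn ([edge_free_ineq]).  For the second
    program the trace is 1.  For the first one, the bordered matrix supplies
    p^2 + 2 p q tr X + q^2 j >= 0 for all p and q ([bordered_quadratic]).  The
    bound on (j - s) / 4 is then elementary; in the first case for g the
    nonnegative s is dropped, in the second it is cancelled by the linear
    inequality.

    Lower bounds.  Let F be the projection onto the lambda2-eigenspace, with one
    removed if lambda2 = r ([second_eigenprojection]).  Up to a multiple of J it
    commutes with everything that commutes with A, in particular with the
    automorphisms, so edge-transitivity makes its entries constant on edges and
    vertex-transitivity makes its diagonal constant.  Those constants are forced
    by the traces of A F and F.  Flipping signs and normalizing turns F into a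
    positive semidefinite f of trace 1 that is orthogonal to J and S and has a
    known negative value on edges ([flipped_eigenprojection]).  Hence
    combinations a J + b f + c S can be made to vanish on edges, have objective
    value n^2 (a - c), and the best admissible coefficients give exactly the
    upper bounds.  Removing one from the eigenspace, rather than averaging a
    single eigenvector over the automorphism group, is what makes the argument
    work for disconnected graphs, whose automorphisms need not preserve the
    bipartition. *)

Set Implicit Arguments.
Unset Strict Implicit.
Unset Printing Implicit Defensive.

Import Order.TTheory GRing.Theory Num.Theory.
Local Open Scope ring_scope.

(** * Orthogonal diagonalization of real symmetric matrices *)

Section RealSpectral.
Variable R : realType.

Lemma row_sqr_norm N (v : 'rV[R]_N) : (v *m v^T) 0 0 = \sum_i v 0 i ^+ 2.
Proof. by rewrite mxE; apply: eq_bigr => i _; rewrite mxE expr2. Qed.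

Lemma row_sqr_norm_ge0 N (v : 'rV[R]_N) : 0 <= (v *m v^T) 0 0.
Proof. by rewrite row_sqr_norm; apply: sumr_ge0 => i _; exact: sqr_ge0. Qed.

Lemma row_sqr_norm_eq0 N (v : 'rV[R]_N) : ((v *m v^T) 0 0 == 0) = (v == 0).
Proof.
apply/eqP/eqP => [|->]; last by rewrite mul0mx mxE.
rewrite row_sqr_norm => /psumr_eq0P v0; apply/rowP => i; rewrite mxE.
by apply/eqP; rewrite -sqrf_eq0 v0 // => j _; exact: sqr_ge0.
Qed.

Lemma row_sqr_norm_gt0 N (v : 'rV[R]_N) : (0 < (v *m v^T) 0 0) = (v != 0).
Proof. by rewrite lt0r row_sqr_norm_eq0 row_sqr_norm_ge0 andbT. Qed.

(** The reflection in the hyperplane orthogonal to u - e0 exchanges the unit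
    vectors e0 and u; it extends u to an orthonormal basis. *)
Lemma householder N (u : 'rV[R]_(1 + N)) : u *m u^T = 1%:M ->
  exists2 H : 'M[R]_(1 + N), H *m H^T = 1%:M & delta_mx 0 0 *m H = u.
Proof.
move=> u1; pose e0 : 'rV[R]_(1 + N) := delta_mx 0 0.
have [ue|une] := eqVneq u e0.
  by exists 1%:M; rewrite ?trmx1 mulmx1 ?ue.
have [w wE] : exists w, w = u - e0 by exists (u - e0).
pose b := (e0 *m u^T) 0 0.
have e0u : e0 *m u^T = b%:M by exact: mx11_scalar.
have ue0 : u *m e0^T = b%:M by rewrite -tr_scalar_mx -e0u trmx_mul trmxK.
have e0e0 : e0 *m e0^T = 1%:M.
  by rewrite trmx_delta mul_delta_mx; apply/matrixP => i j; rewrite !ord1 !mxE.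
have e0w : e0 *m w^T = (b - 1)%:M.
  by rewrite wE linearB /= mulmxBr e0u e0e0 -raddfB.
have ww : w *m w^T = (2 * (1 - b))%:M.
  rewrite {1}wE mulmxBl e0w wE linearB /= mulmxBr u1 ue0 -!raddfB /=.
  by congr (_%:M); ring.
have b1 : 1 - b != 0.
  have : (w *m w^T) 0 0 != 0 by rewrite row_sqr_norm_eq0 wE subr_eq0.
  by rewrite ww mxE eqxx mulr1n mulf_eq0 negb_or => /andP[].
pose H := 1%:M - (1 - b)^-1 *: (w^T *m w).
have Hs : H^T = H by rewrite linearB linearZ /= trmx1 trmx_mul trmxK.
exists H.
  rewrite Hs /H mulmxBl mul1mx mulmxBr mulmx1 -scalemxAl -scalemxAr.
  rewrite mulmxA -(mulmxA w^T) ww mul_mx_scalar -scalemxAl !scalerA.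
  rewrite -addrA -opprD -scalerBl -scalerDl.
  rewrite [X in X *: _](_ : _ = 0) ?scale0r ?subr0 //; field; exact: b1.
rewrite -/e0 /H mulmxBr mulmx1 -scalemxAr mulmxA e0w mul_scalar_mx scalerA.
rewrite (_ : (1 - b)^-1 * _ = -1); last by field; exact: b1.
by rewrite scaleN1r opprK wE addrC subrK.
Qed.

(** Induction on the size: an orthogonal matrix whose first row is a unit
    eigenvector for the first x in s splits x off as a 1 x 1 block, and the
    remaining block has characteristic polynomial the product over the rest of
    s.  The order of s is respected, so that sorted eigenvalues can be used. *)
Lemma real_spectral N (A : 'M[R]_N) (s : seq R) :
    A^T = A -> char_poly A = \prod_(x <- s) ('X - x%:P) ->
  exists2 U : 'M[R]_N, U *m U^T = 1%:M & A = U^T *m diag_mx (\row_i s`_i) *m U.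
Proof.
elim: N A s => [|N IHN] A s As cA.
  by exists 1%:M; [rewrite trmx1 mulmx1|apply/matrixP => [[]]].
have ss : size s = N.+1.
  have := size_char_poly A; rewrite cA size_prod_XsubC; by case.
case: s ss cA => // x s [ss] cA.
have /eigenvalueP[v vA v0] : eigenvalue A x.
  by rewrite eigenvalue_root_char cA big_cons rootM root_XsubC eqxx.
pose c := Num.sqrt ((v *m v^T) 0 0); pose u : 'rV[R]_(1 + N) := c^-1 *: v.
have vv : 0 < (v *m v^T) 0 0 by rewrite row_sqr_norm_gt0.
have u1 : u *m u^T = 1%:M.
  rewrite /u linearZ /= -scalemxAl -scalemxAr scalerA -expr2 exprVn.
  rewrite [v *m v^T]mx11_scalar sqr_sqrtr 1?ltW // scale_scalar_mx mulVf //.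
  by rewrite gt_eqF.
have uA : u *m A = x *: u by rewrite -scalemxAl vA scalerA mulrC -scalerA.
have [H HH He] := householder u1.
pose A1 : 'M[R]_(1 + N) := H *m A *m H^T.
have A1s : A1^T = A1 by rewrite /A1 !trmx_mul trmxK As mulmxA.
have A1e : delta_mx 0 0 *m A1 = x *: delta_mx 0 0 :> 'rV[R]_(1 + N).
  by rewrite /A1 !mulmxA He uA -scalemxAl -He -mulmxA HH mulmx1.
have A1u : usubmx A1 = row_mx x%:M 0.
  have : row 0 A1 = x *: delta_mx 0 0 by rewrite rowE.
  move=> /rowP h; apply/matrixP => i j; rewrite !ord1 mxE.
  have := h j; rewrite mxE (_ : lshift _ 0 = 0) => [->|]; last exact/val_inj.
  case: (split_ordP j) => k ->; rewrite ?row_mxEl ?row_mxEr !mxE /=.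
    by rewrite !ord1 -val_eqE /= mulr1.
  by rewrite mulr0.
pose A2 := drsubmx A1.
have A1E : A1 = block_mx x%:M 0 0 A2.
  rewrite -[LHS]submxK; congr block_mx.
  - by rewrite /ulsubmx A1u row_mxKl.
  - by rewrite /ursubmx A1u row_mxKr.
  - by rewrite -[LHS]trmxK trmx_dlsub A1s /ursubmx A1u row_mxKr trmx0.
have A2s : A2^T = A2 by rewrite trmx_drsub A1s.
have HTH : H^T *m H = 1%:M by exact: mulmx1C.
have AA1 : A = H^T *m A1 *m H.
  by rewrite /A1 !mulmxA HTH mul1mx -mulmxA HTH mulmx1.
have cA2 : char_poly A2 = \prod_(y <- s) ('X - y%:P).
  have Hu : H \in unitmx by case: (mulmx1_unit HH).
  have Hi : invmx H = H^T by rewrite -[RHS](mulKmx Hu) HH mulmx1.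
  have : char_poly A = ('X - x%:P) * char_poly A2.
    rewrite AA1 -Hi char_poly_conj // A1E /char_poly (@char_block_diag_mx _ 1 N).
    rewrite (@det_ublock _ 1 N); congr (_ * _).
    by rewrite /char_poly_mx map_scalar_mx -raddfB /= det_scalar expr1.
  rewrite cA big_cons => /mulfI -> //.
  by rewrite polyXsubC_eq0.
have [U2 U2U A2E] := IHN A2 s A2s cA2.
pose V : 'M[R]_(1 + N) := block_mx 1%:M 0 0 U2.
have VT : V^T = block_mx 1%:M 0 0 U2^T by rewrite tr_block_mx !trmx0 trmx1.
exists (V *m H).
  rewrite trmx_mul mulmxA -(mulmxA V) HH mulmx1 VT /V.
  rewrite (@mulmx_block _ 1 N 1 N 1 N).
  by rewrite !mulmx0 !mul0mx mulmx1 !addr0 !add0r U2U -scalar_mx_block.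
rewrite AA1 A1E A2E trmx_mul !mulmxA; congr (_ *m H).
rewrite -!mulmxA; congr (H^T *m _).
have -> : diag_mx (\row_i (x :: s)`_i) =
    block_mx x%:M 0 0 (diag_mx (\row_i s`_i)) :> 'M[R]_(1 + N).
  rewrite (_ : \row_i _ = row_mx x%:M (\row_i s`_i) :> 'rV[R]_(1 + N)).
    rewrite diag_mx_row; congr block_mx.
    by apply/matrixP => i j; rewrite !ord1 !mxE.
  apply/rowP => i; rewrite mxE; case: (split_ordP i) => k ->.
    by rewrite row_mxEl ord1 mxE.
  by rewrite row_mxEr mxE.
rewrite VT /V !(@mulmx_block _ 1 N 1 N 1 N) !mulmx0 !mul0mx !mulmx1 !mul1mx.
by rewrite !addr0 !add0r mulmx0.
Qed.

Lemma eigenvectors_orthogonal N (v : 'rV[R]_N) a b (B F : 'M[R]_N) :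
  v *m B = a *: v -> B *m F = b *: F -> a != b -> v *m F = 0.
Proof.
move=> vB BF ab; have : (a - b) *: (v *m F) = 0.
  by rewrite scalerBl scalemxAl -vB -mulmxA BF -scalemxAr subrr.
by move/eqP; rewrite scaler_eq0 subr_eq0 (negPf ab) => /eqP.
Qed.

(** In the orthonormal basis U, a matrix commutes with diag d exactly when its
    entry (i, j) vanishes unless d_i = d_j, and this passes to g applied to d. *)
Lemma spectral_commute N (U S : 'M[R]_N) (d : 'rV[R]_N) (g : R -> R) :
    U *m U^T = 1%:M -> comm_mx S (U^T *m diag_mx d *m U) ->
  comm_mx S (U^T *m diag_mx (map_mx g d) *m U).
Proof.
move=> UU SA; have UTU := mulmx1C UU.
have [M SE] : exists M, S = U^T *m M *m U.
  by exists (U *m S *m U^T); rewrite !mulmxA UTU mul1mx -mulmxA UTU mulmx1.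
have conjE (X Y : 'M[R]_N) :
    U^T *m X *m U *m (U^T *m Y *m U) = U^T *m (X *m Y) *m U.
  by rewrite !mulmxA -(mulmxA _ U) UU mulmx1.
have Md : M *m diag_mx d = diag_mx d *m M.
  move: SA; rewrite /comm_mx SE !conjE => /(congr1 (fun X => U *m X *m U^T)).
  by rewrite !mulmxA UU !mul1mx -!(mulmxA _ U) UU !mulmx1.
rewrite /comm_mx SE !conjE; congr (_ *m _ *m _).
apply/matrixP => i j; have := congr1 (fun X : 'M[R]_N => X i j) Md.
rewrite !mul_mx_diag !mul_diag_mx !mxE.
have [-> _|M0] := eqVneq (M i j) 0; first by rewrite mulr0 mul0r.
by rewrite mulrC => /(mulIf M0) ->; rewrite mulrC.
Qed.

Lemma eigenvector_coord N (U : 'M[R]_N) (d u : 'rV[R]_N) a i :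
    U *m U^T = 1%:M -> u *m (U^T *m diag_mx d *m U) = a *: u ->
  (u *m U^T) 0 i * (d 0 i - a) = 0.
Proof.
move=> UU uA; have : (u *m U^T) *m diag_mx d = a *: (u *m U^T).
  by rewrite scalemxAl -uA !mulmxA -(mulmxA _ U) UU mulmx1.
move=> /rowP/(_ i); rewrite mul_mx_diag mxE [RHS]mxE => h.
by rewrite mulrBr h mulrC subrr.
Qed.

End RealSpectral.

(** * Positive semidefinite matrices *)

Section PositiveSemidefinite.
Variable R : realType.

Lemma psdD N (X Y : 'M[R]_N) : psd X -> psd Y -> psd (X + Y).
Proof.
move=> [Xs Xp] [Ys Yp]; split=> [|v]; first by rewrite linearD /= Xs Ys.
by rewrite mulmxDr mulmxDl mxE addr_ge0.
Qed.

Lemma psdZ N (a : R) (X : 'M[R]_N) : 0 <= a -> psd X -> psd (a *: X).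
Proof.
move=> a0 [Xs Xp]; split=> [|v]; first by rewrite linearZ /= Xs.
by rewrite -scalemxAr -scalemxAl mxE mulr_ge0.
Qed.

Lemma psd_conj M N (P : 'M[R]_(M, N)) (X : 'M[R]_M) :
  psd X -> psd (P^T *m X *m P).
Proof.
move=> [Xs Xp]; split=> [|v]; first by rewrite !trmx_mul trmxK Xs mulmxA.
by have := Xp (v *m P^T); rewrite trmx_mul trmxK !mulmxA.
Qed.

Lemma psd_diag N (d : 'rV[R]_N) : (forall i, 0 <= d 0 i) -> psd (diag_mx d).
Proof.
move=> d0; split=> [|v]; first exact: tr_diag_mx.
rewrite mxE; apply: sumr_ge0 => i _.
by rewrite mul_mx_diag !mxE mulrAC -expr2 mulr_ge0 ?sqr_ge0.
Qed.

Lemma psd_diag_ge0 N (X : 'M[R]_N) i : psd X -> 0 <= X i i.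
Proof.
by move=> Xp; have := psd_ge_abs i i Xp; have := normr_ge0 (X i i); lra.
Qed.

Lemma mxtrace_row_mul N (v : 'rV[R]_N) (X : 'M[R]_N) :
  \tr (v^T *m v *m X) = (v *m X *m v^T) 0 0.
Proof. by rewrite -mulmxA mxtrace_mulC /mxtrace big_ord1. Qed.

Lemma spectral_diag_ge0 N (U : 'M[R]_N) (d : 'rV[R]_N) :
  U *m U^T = 1%:M -> psd (U^T *m diag_mx d *m U) -> forall i, 0 <= d 0 i.
Proof.
move=> UU /(psd_conj U^T); rewrite trmxK !mulmxA UU mul1mx -mulmxA UU mulmx1.
by move=> + i => /(psd_diag_ge0 i); rewrite mxE eqxx mulr1n.
Qed.

(** Weak duality rests on this self-duality of the semidefinite cone.  After
    diagonalizing X, the trace is a combination with nonnegative coefficients of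
    diagonal entries of a conjugate of Y. *)
Lemma mxtrace_psd_ge0 N (X Y : 'M[R]_N) : psd X -> psd Y -> 0 <= \tr (X *m Y).
Proof.
move=> Xp Yp; have [s Xs] := char_poly_sym_split Xp.1.
have [U UU XE] := real_spectral Xp.1 Xs; set d := \row_i _ in XE.
have d0 : forall i, 0 <= d 0 i by apply: spectral_diag_ge0 UU _; rewrite -XE.
rewrite XE -!mulmxA mxtrace_mulC -mulmxA; apply: sumr_ge0 => i _.
rewrite mul_diag_mx mxE mulr_ge0 //.
by have := psd_conj U^T Yp; rewrite trmxK => /(psd_diag_ge0 i).
Qed.

End PositiveSemidefinite.

(** * The second largest eigenvalue *)

Section SecondEigenvalue.
Variables (R : realType) (N : nat) (A : 'M[R]_N) (u : 'rV[R]_N) (r : R).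
Hypotheses (A_sym : A^T = A) (u_neq0 : u != 0) (uA : u *m A = r *: u).
Hypothesis A_le : psd (r%:M - A).
Hypothesis N_gt1 : (1 < N)%N.

Let l2 := lambda2 A.

Lemma spectral_lambda2 : exists U : 'M[R]_N, exists d : 'rV[R]_N,
  [/\ U *m U^T = 1%:M, A = U^T *m diag_mx d *m U, forall i, d 0 i <= r,
      forall i : 'I_N, (0 < i)%N -> d 0 i <= l2 &
      forall i : 'I_N, (i < 2)%N -> l2 <= d 0 i].
Proof.
have [es eE] := eigenvaluesP A_sym; rewrite /l2 /lambda2.
move: (eigenvalues A) es eE => t t_sorted At.
have [U UU AE] := real_spectral A_sym At.
have ts : size t = N.
  by have := size_char_poly A; rewrite At size_prod_XsubC => -[].
have mono i j : (i <= j < N)%N -> t`_j <= t`_i.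
  move=> /andP[ij jN].
  have ge_trans : transitive (>=%R : rel R).
    by move=> x y z yx zy; exact: le_trans zy yx.
  apply: (sorted_leq_nth ge_trans (@lexx _ _) 0 t_sorted) => //.
    by rewrite inE ts (leq_ltn_trans ij).
  by rewrite inE ts.
exists U, (\row_i t`_i); split=> //.
- move=> i; rewrite -subr_ge0.
  have := psd_conj U^T A_le; rewrite trmxK mulmxBr mulmxBl mul_mx_scalar.
  rewrite -scalemxAl UU AE !mulmxA UU mul1mx -mulmxA UU mulmx1.
  by move=> /(psd_diag_ge0 i); rewrite !mxE eqxx mulr1 mulr1n.
- by move=> i i0; rewrite mxE mono // i0 ltn_ord.
- by move=> i; rewrite mxE ltnS => i1; rewrite mono // i1.
Qed.

Let nu := (u *m u^T) 0 0.

(** Deflation replaces the top eigenvalue r of A by lambda2.  If r > lambda2,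
    then all coordinates of u but the first vanish in the sorted eigenbasis, so
    the matrix below is diagonal in that basis, with entries lambda2 - d_i, where
    the first entry is raised to 0.  If r = lambda2, it is r I - A. *)
Lemma deflation_psd :
  psd (l2%:M - A + ((r - l2) / nu) *: (u^T *m u)).
Proof.
have [U [d [UU AE dr d2 dl]]] := spectral_lambda2.
have UTU := mulmx1C UU.
have l2r : l2 <= r := le_trans (dl (Ordinal N_gt1) isT) (dr _).
have nu0 : nu != 0 by rewrite row_sqr_norm_eq0.
have [rl2|rl2] := eqVneq r l2.
  by rewrite rl2 subrr mul0r scale0r addr0 -rl2.
pose k0 := Ordinal (ltnW N_gt1).
have [c cE] : exists c, c = u *m U^T by exists (u *m U^T).
have uE : u = c *m U by rewrite cE -mulmxA UTU mulmx1.
have cd i : c 0 i * (d 0 i - r) = 0.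
  by rewrite cE eigenvector_coord // -AE.
have ci0 i : i != k0 -> c 0 i = 0.
  move=> ik; have /eqP := cd i; rewrite mulf_eq0 => /orP[/eqP //|].
  rewrite subr_eq0 => /eqP di; have : r <= l2 by rewrite -di d2 // lt0n.
  by rewrite le_eqVlt (negPf rl2) ltNge l2r.
have ck0 : c = c 0 k0 *: delta_mx 0 k0.
  apply/rowP => i; rewrite !mxE eqxx /=.
  by have [->|ik] := eqVneq i k0; rewrite ?mulr1 // mulr0 ci0.
have nuE : nu = c 0 k0 ^+ 2.
  rewrite /nu uE trmx_mul mulmxA -(mulmxA c) UU mulmx1 {1 2}ck0.
  rewrite row_sqr_norm (bigD1 k0) //= big1 => [|i ik].
    by rewrite addr0 !mxE !eqxx mulr1.
  by rewrite !mxE (negPf ik) andbF mulr0 expr0n.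
have dk0 : d 0 k0 = r.
  have /eqP := cd k0; rewrite mulf_eq0 subr_eq0 => /orP[|/eqP //].
  by rewrite -sqrf_eq0 -nuE (negPf nu0).
have -> : l2%:M - A + ((r - l2) / nu) *: (u^T *m u) =
    U^T *m diag_mx (\row_i ((l2 - d 0 i) + (r - l2) *+ (i == k0))) *m U.
  have -> : diag_mx (\row_i (l2 - d 0 i + (r - l2) *+ (i == k0))) =
      l2%:M - diag_mx d + ((r - l2) / nu) *: (c^T *m c).
    apply/matrixP => i j; rewrite !mxE big_ord1 !mxE.
    rewrite mulrnDl mulrnBl; congr (_ + _).
    rewrite [in RHS]ck0 !mxE !eqxx /= nuE.
    have c0 : c 0 k0 != 0 by rewrite -sqrf_eq0 -nuE.
    have [->|ik] := eqVneq i k0; last first.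
      by rewrite !mulr0 !mul0r !mulr0 mulr0n mul0rn.
    have [jk|jk] := eqVneq j k0; last by rewrite !mulr0 mulr0n.
    by rewrite !mulr1 -expr2 divfK ?sqrf_eq0.
  rewrite mulmxDr mulmxDl mulmxBr mulmxBl mul_mx_scalar -scalemxAl UTU.
  by rewrite -AE -scalemxAr -scalemxAl uE trmx_mul !mulmxA scalemx1.
apply: psd_conj; apply: psd_diag => i; rewrite mxE.
have [->|ik] := eqVneq i k0; first by rewrite dk0 mulr1n -opprB addNr.
by rewrite mulr0n addr0 subr_ge0 d2 // lt0n.
Qed.

(** F is the projection E onto the eigenspace of lambda2, minus the projection P
    onto u when r = lambda2.  It is nonzero since lambda2 is the second
    eigenvalue: when r = lambda2, both of the first two eigenvalues are r, so
    tr E >= 2 and u does not exhaust the eigenspace.  E commutes with whatever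
    commutes with A; P need not, which is why it is added back at the end. *)
Lemma second_eigenprojection : exists F : 'M[R]_N, exists c : R,
  [/\ psd F, A *m F = l2 *: F, u *m F = 0, 0 < \tr F &
      forall S, comm_mx S A -> comm_mx S (F + c *: (u^T *m u))].
Proof.
have [U [d [UU AE dr d2 dl]]] := spectral_lambda2.
have UTU := mulmx1C UU.
have nu0 : nu != 0 by rewrite row_sqr_norm_eq0.
pose g x : R := (x == l2)%:R.
pose E := U^T *m diag_mx (map_mx g d) *m U.
have Es : E^T = E by rewrite /E !trmx_mul trmxK tr_diag_mx mulmxA.
have Ep : psd E by apply: psd_conj; apply: psd_diag => i; rewrite mxE ler0n.
have EE : E *m E = E.
  rewrite /E !mulmxA -(mulmxA _ U) UU mulmx1 -(mulmxA U^T) mulmx_diag.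
  congr (_ *m diag_mx _ *m _); apply/rowP => i.
  by rewrite !mxE -natrM mulnb andbb.
have AF : A *m E = l2 *: E.
  rewrite {1}AE /E !mulmxA -(mulmxA _ U) UU mulmx1 -(mulmxA U^T) mulmx_diag.
  rewrite scalemxAl scalemxAr; congr (_ *m _ *m _); apply/matrixP => i j.
  rewrite !mxE -mulrnAr; case: (i == j); rewrite ?mulr0n ?mulr0 // !mulr1n /g.
  by case: eqP => [->|]; rewrite ?mulr0.
have trE : \tr E = \sum_i g (d 0 i).
  rewrite /E mxtrace_mulC mulmxA UU mul1mx mxtrace_diag.
  by apply: eq_bigr => i _; rewrite mxE.
have g0 i : 0 <= g (d 0 i) by rewrite ler0n.
pose k1 := Ordinal N_gt1; pose k0 := Ordinal (ltnW N_gt1).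
have gk1 : g (d 0 k1) = 1.
  rewrite /g (_ : d 0 k1 = l2) ?eqxx //.
  by apply/eqP; rewrite eq_le d2 // dl.
have Ec S : comm_mx S A -> comm_mx S E.
  by rewrite [X in comm_mx S X -> _]AE; exact: spectral_commute.
have [rl2|rl2] := eqVneq r l2; last first.
  exists E, 0; split=> //.
  - exact: eigenvectors_orthogonal uA AF rl2.
  - rewrite trE (bigD1 k1) //= gk1 ltr_pwDl //; exact: sumr_ge0.
  - by move=> S /Ec; rewrite scale0r addr0.
have gk0 : g (d 0 k0) = 1.
  rewrite /g (_ : d 0 k0 = l2) ?eqxx //.
  by apply/eqP; rewrite eq_le dl // -rl2 dr.
pose P := nu^-1 *: (u^T *m u).
have uE : u *m E = u.
  have uc i : (u *m U^T) 0 i * (d 0 i - r) = 0.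
    by rewrite eigenvector_coord // -AE.
  rewrite /E !mulmxA -[RHS]mulmx1 -UTU mulmxA; congr (_ *m _).
  apply/rowP => i; rewrite mul_mx_diag mxE [map_mx _ _ _ _]mxE /g.
  have /eqP := uc i; rewrite mulf_eq0 subr_eq0 rl2 => /orP[/eqP ->|->].
    by rewrite mul0r.
  by rewrite mulr1.
have uu : u *m u^T = nu%:M by exact: mx11_scalar.
have uP : u *m P = u.
  by rewrite /P -scalemxAr mulmxA uu mul_scalar_mx scalerA mulVf // scale1r.
have Ps : P^T = P by rewrite /P linearZ /= trmx_mul trmxK.
have PP : P *m P = P.
  by rewrite {1}/P -scalemxAl -mulmxA uP.
have PE : P *m E = P by rewrite /P -scalemxAl -mulmxA uE.
have EP : E *m P = P by rewrite -Ps -Es -trmx_mul PE.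
have FF : (E - P) *m (E - P) = E - P.
  by rewrite mulmxBl !mulmxBr EE PE EP PP subrr subr0.
exists (E - P), nu^-1; split.
- rewrite -FF; have {1}-> : E - P = (E - P)^T by rewrite linearB /= Es Ps.
  rewrite -[_^T]mulmx1; apply: psd_conj; rewrite -diag_const_mx.
  by apply: psd_diag => i; rewrite mxE ler01.
- rewrite mulmxBr AF scalerBr -rl2 /P -scalemxAr mulmxA; congr (_ - _).
  rewrite -[A]A_sym -trmx_mul uA linearZ /= -scalemxAl.
  by rewrite !scalerA mulrC.
- by rewrite mulmxBr uE uP subrr.
- rewrite linearB /= trE (bigD1 k1) //= (bigD1 k0) //= gk0 gk1.
  rewrite [\tr P]linearZ /= mxtrace_mulC uu mxtrace_scalar mulr1n mulVf //.
  rewrite addrA -addrAC addrK ltr_pwDl //; exact: sumr_ge0.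
- by move=> S /Ec; rewrite subrK.
Qed.

End SecondEigenvalue.

(** * Bordered matrices *)

Section BorderedMatrices.
Variables (R : realType) (N : nat).
Local Notation one := (const_mx 1 : 'rV[R]_N).

Lemma bordered_quadratic (X : 'M[R]_N) (p q : R) : psd (bordered X) ->
  0 <= p ^+ 2 + 2 * (p * q) * \tr X + q ^+ 2 * (one *m X *m one^T) 0 0.
Proof.
move=> [_ /(_ (row_mx p%:M (q *: one)))].
rewrite /bordered mul_row_block tr_row_mx mul_row_col tr_scalar_mx.
rewrite [(q *: one)^T]linearZ /= mulmx1 !mulmxDl !mul_scalar_mx.
have o1 : one *m (\col_i X i i) = (\tr X)%:M.
  rewrite [LHS]mx11_scalar; congr (_%:M); rewrite mxE.
  by apply: eq_bigr => i _; rewrite !mxE mul1r.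
have o2 : (\col_i X i i)^T *m one^T = (\tr X)%:M.
  by rewrite -trmx_mul o1 tr_scalar_mx.
rewrite -!scalemxAl o1 -!scalemxAr o2.
set Z := _ *m one^T; rewrite -scalar_mxM !mxE /= !mulr1n => h.
by apply: le_trans h _; rewrite le_eqVlt; apply/orP; left; apply/eqP; ring.
Qed.

(** The bordered matrix is the rank-one matrix of (1, x, ..., x) plus Y put in
    the lower right block: this is the Schur complement criterion for a matrix
    with constant diagonal. *)
Lemma psd_bordered (x : R) (X Y : 'M[R]_N) :
    (forall i, X i i = x) -> psd Y -> X = x ^+ 2 *: (one^T *m one) + Y ->
  psd (bordered X).
Proof.
move=> Xd Yp XE.
have -> : bordered X = (row_mx 1%:M (x *: one))^T *m row_mx 1%:M (x *: one) +
    (row_mx 0 1%:M)^T *m Y *m (row_mx 0 1%:M : 'M[R]_(N, 1 + N)).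
  rewrite !tr_row_mx -mulmxA [Y *m _]mul_mx_row mulmx0 mulmx1 !mul_col_row.
  rewrite !trmx1 trmx0 !mul0mx !mul1mx add_block_mx !addr0 mulmx1.
  rewrite /bordered; congr block_mx.
  - by apply/matrixP => i j; rewrite !mxE Xd mulr1.
  - by apply/matrixP => i j; rewrite !mxE Xd mulr1.
  - rewrite [in LHS]XE; congr (_ + _).
    by rewrite [(x *: one)^T]linearZ /= -scalemxAl -scalemxAr scalerA expr2.
by apply: psdD; [exact: psd_sqr | exact: psd_conj].
Qed.

End BorderedMatrices.

(** * Regular bipartite graphs *)

Section RegularBipartite.
Variables (R : realType) (T : finType) (e : rel T).
Variables (V1 V2 : {set T}) (r n : nat).
Hypotheses (e_sym : symmetric e) (e_bip : bipartition e V1 V2).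
Hypotheses (e_reg : regular e r) (r_ge1 : (1 <= r)%N).
Hypotheses (cardV1 : #|V1| = n) (cardV2 : #|V2| = n) (n_ge2 : (2 <= n)%N).

Local Notation N := #|T|.
Local Notation A := (adjacency R e).
Local Notation one := (const_mx 1 : 'rV[R]_N).
Local Notation l2 := (lambda2 A).
Let nu : R := N%:R.

Definition side_sign : 'rV[R]_N :=
  \row_i (if enum_val i \in V1 then 1 else -1).
Local Notation sgn := side_sign.
Local Notation D := (diag_mx sgn).

Lemma in_V2 x : (x \in V2) = (x \notin V1).
Proof.
have [cov dis _] := e_bip.
have : x \in V1 :|: V2 by rewrite cov inE.
rewrite inE; have [x1|//] := boolP (x \in V1) => _.
by rewrite (disjointFr dis).
Qed.

Lemma cardT : N = (2 * n)%N.
Proof.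
have [cov dis _] := e_bip.
rewrite -cardsT -cov cardsU (disjoint_setI0 dis) cards0 subn0 cardV1 cardV2.
by rewrite mul2n addnn.
Qed.

Lemma nuE : nu = 2 * n%:R. Proof. by rewrite /nu cardT natrM. Qed.
Lemma n_gt0 : 0 < n%:R :> R. Proof. by rewrite ltr0n ltnW. Qed.
Lemma nu_gt0 : 0 < nu. Proof. by rewrite nuE; have := n_gt0; lra. Qed.
Lemma r_gt0 : 0 < r%:R :> R. Proof. by rewrite ltr0n. Qed.
Lemma N_gt1 : (1 < N)%N.
Proof. by rewrite cardT mul2n -addnn (leq_trans n_ge2) // leq_addr. Qed.

Lemma sum_enum_val (f : T -> R) : \sum_(i < N) f (enum_val i) = \sum_x f x.
Proof.
rewrite [RHS](reindex (fun i : 'I_N => enum_val i)) //=.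
exact/onW_bij/enum_val_bij.
Qed.

Lemma sgn_sqr i : sgn 0 i * sgn 0 i = 1.
Proof. by rewrite mxE; case: ifP; rewrite ?mulr1 ?mulrNN ?mulr1. Qed.

Lemma sgn_edge i j : A i j != 0 -> sgn 0 i = - sgn 0 j.
Proof.
rewrite !mxE pnatr_eq0 eqb0 negbK => /(let: And3 _ _ h := e_bip in h _ _).
rewrite /cross !in_V2; case: (_ \in V1); case: (_ \in V1) => //.
by rewrite opprK.
Qed.

Lemma adjacency_sym : A^T = A.
Proof. by apply/matrixP => i j; rewrite !mxE e_sym. Qed.

Lemma one_adjacency : one *m A = r%:R *: one.
Proof.
apply/rowP => j; rewrite !mxE mulr1 -(e_reg (enum_val j)) -sum1_card natr_sum.
rewrite [RHS]big_mkcond -sum_enum_val; apply: eq_bigr => i _.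
by rewrite !mxE mul1r inE e_sym; case: (e _ _).
Qed.

Lemma sgn_adjacency : sgn *m A = - r%:R *: sgn.
Proof.
apply/rowP => j; rewrite !mxE.
have /rowP/(_ j) := one_adjacency; rewrite !mxE mulr1 => <-.
rewrite mulNr mulr_suml -sumrN; apply: eq_bigr => i _.
have [->|/sgn_edge ->] := eqVneq (A i j) 0; first by rewrite !mulr0 mul0r oppr0.
by rewrite !mxE mul1r mulNr mulrC.
Qed.

Lemma one_norm : one *m one^T = nu%:M.
Proof.
rewrite [LHS]mx11_scalar row_sqr_norm; congr (_%:M).
by under eq_bigr do rewrite mxE expr1n; rewrite sumr_const card_ord.
Qed.

Lemma one_sgn : one *m sgn^T = 0.
Proof.
rewrite [LHS]mx11_scalar [X in X%:M](_ : _ = 0) ?raddf0 // mxE.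
under eq_bigr do rewrite !mxE mul1r.
rewrite (sum_enum_val (fun x => if x \in V1 then 1 else -1)).
rewrite (bigID (mem V1)) /= (eq_bigr (fun=> 1)) => [|x -> //].
rewrite [X in _ + X](eq_bigr (fun=> -1)) => [|x /negPf -> //].
rewrite [X in _ + X](eq_bigl (mem V2)) => [|x]; last by rewrite /= in_V2.
by rewrite !sumr_const cardV1 cardV2 mulNrn subrr.
Qed.

Lemma one_diag : one *m D = sgn.
Proof. by apply/rowP => i; rewrite mul_mx_diag !mxE mul1r. Qed.

Lemma diag_diag : D *m D = 1%:M.
Proof.
rewrite mulmx_diag -diag_const_mx; congr diag_mx.
by apply/rowP => i; rewrite mxE sgn_sqr mxE.
Qed.

Lemma sgn_diag : sgn *m D = one.
Proof. by rewrite -{1}one_diag -mulmxA diag_diag mulmx1. Qed.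

Lemma sgn_norm : sgn *m sgn^T = nu%:M.
Proof.
by rewrite -{1}one_diag -mulmxA -[D]tr_diag_mx -trmx_mul sgn_diag one_norm.
Qed.

Lemma diag_adjacency : D *m A *m D = - A.
Proof.
apply/matrixP => i j; rewrite mul_mx_diag mxE mul_diag_mx mxE [RHS]mxE.
have [->|/sgn_edge ->] := eqVneq (A i j) 0; first by rewrite mulr0 mul0r oppr0.
by rewrite mulNr mulNr mulrAC sgn_sqr mul1r.
Qed.

(** The quadratic form of r I - A at v is half the sum of (v_i - v_j)^2 over the
    ordered pairs of adjacent vertices. *)
Lemma adjacency_le : psd (r%:R%:M - A).
Proof.
split=> [|v]; first by rewrite linearB /= tr_scalar_mx adjacency_sym.
have deg i : \sum_j A i j = r%:R.
  have /rowP/(_ i) := one_adjacency; rewrite !mxE mulr1 => <-.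
  by apply: eq_bigr => j _; rewrite !mxE mul1r e_sym.
have vAv : (v *m A *m v^T) 0 0 = \sum_i \sum_j v 0 i * A i j * v 0 j.
  rewrite mxE exchange_big; apply: eq_bigr => j _.
  by rewrite !mxE mulr_suml.
have rvv : r%:R * (v *m v^T) 0 0 = \sum_i \sum_j A i j * v 0 i ^+ 2.
  rewrite row_sqr_norm mulr_sumr; apply: eq_bigr => i _.
  by rewrite -mulr_suml deg.
have rvv' : r%:R * (v *m v^T) 0 0 = \sum_i \sum_j A i j * v 0 j ^+ 2.
  rewrite rvv exchange_big; apply: eq_bigr => j _; apply: eq_bigr => i _.
  by rewrite !mxE e_sym.
have -> : (v *m (r%:R%:M - A) *m v^T) 0 0 =
    r%:R * (v *m v^T) 0 0 - (v *m A *m v^T) 0 0.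
  rewrite mulmxBr mulmxBl mul_mx_scalar -scalemxAl mxE.
  by rewrite [X in X + _]mxE [X in _ + X]mxE.
have : 0 <= \sum_i \sum_j A i j * (v 0 i - v 0 j) ^+ 2.
  apply: sumr_ge0 => i _; apply: sumr_ge0 => j _.
  by rewrite mulr_ge0 ?sqr_ge0 // mxE ler0n.
have -> : \sum_i \sum_j A i j * (v 0 i - v 0 j) ^+ 2 =
    r%:R * (v *m v^T) 0 0 + r%:R * (v *m v^T) 0 0 - 2 * (v *m A *m v^T) 0 0.
  rewrite {1}rvv rvv' vAv mulr_sumr -big_split -sumrB; apply: eq_bigr => i _.
  by rewrite mulr_sumr -big_split -sumrB; apply: eq_bigr => j _ /=; ring.
by move=> h; lra.
Qed.

Lemma objective_inner (X : 'M[R]_N) : inner_mx (objective R V1 V2) X =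
  4^-1 * ((one *m X *m one^T) 0 0 - (sgn *m X *m sgn^T) 0 0).
Proof.
rewrite -!mxtrace_row_mul -raddfB /= -mulmxBl -linearZ /= scalemxAl /inner_mx.
congr (\tr (_ *m _)); apply/matrixP => i j.
rewrite !mxE !big_ord1 !mxE /cross !in_V2.
case: (_ \in V1); case: (_ \in V1) => /=; by [field|lra].
Qed.

(** * Upper bounds *)

Lemma one_neq0 : one != 0.
Proof. by rewrite -row_sqr_norm_gt0 one_norm mxE eqxx mulr1n nu_gt0. Qed.

Lemma one_deflation_psd :
  psd (l2%:M - A + ((r%:R - l2) / nu) *: (one^T *m one)).
Proof.
have := deflation_psd adjacency_sym one_neq0 one_adjacency adjacency_le N_gt1.
by rewrite one_norm [X in _ / X]mxE eqxx mulr1n.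
Qed.

(** Two vertices on the same side of the bipartition are not adjacent, so the
    quadratic form of A vanishes at the difference of their indicator vectors,
    which is orthogonal to one. *)
Lemma lambda2_ge0 : 0 <= l2.
Proof.
have /card_gt1P[x [y [xV yV xy]]] : (1 < #|V1|)%N by rewrite cardV1.
have nadj i j : enum_val i \in V1 -> enum_val j \in V1 -> A i j = 0.
  rewrite mxE; case: (boolP (e _ _)) => // /(let: And3 _ _ h := e_bip in h _ _).
  by move=> h iV jV; move: h; rewrite /cross !in_V2 iV jV.
have := psd_ge_abs (enum_rank x) (enum_rank y) one_deflation_psd.
have oo i j : (one^T *m one) i j = 1 by rewrite mxE big_ord1 !mxE mulr1.
have E i j : (l2%:M - A + ((r%:R - l2) / nu) *: (one^T *m one)) i j =
    l2 *+ (i == j) - A i j + (r%:R - l2) / nu.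
  by rewrite mxE [X in X + _]mxE [X in X + _ + _]mxE [X in _ + X + _]mxE
    [X in _ + X]mxE oo mulr1.
rewrite !E !nadj ?enum_rankK // !eqxx (inj_eq enum_rank_inj) (negPf xy) => h.
have := ler_norm ((r%:R - l2) / nu).
by move: h; rewrite mulr0n mulr1n !subr0 add0r; lra.
Qed.

Lemma sgn_deflation_psd :
  psd (l2%:M + A + ((r%:R - l2) / nu) *: (sgn^T *m sgn)).
Proof.
have := psd_conj D one_deflation_psd; rewrite tr_diag_mx.
rewrite mulmxDr mulmxBr mulmxDl mulmxBl diag_adjacency opprK mul_mx_scalar.
rewrite -!scalemxAl diag_diag scalemx1 -scalemxAr -scalemxAl.
have -> : D *m (one^T *m one) *m D = sgn^T *m sgn.
  rewrite mulmxA -mulmxA one_diag -[X in X *m one^T]tr_diag_mx.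
  by rewrite -trmx_mul one_diag.
by [].
Qed.

(** Compress the matrix M of the previous lemma to the orthogonal complement of
    one.  Since one is an eigenvector of M for r + lambda2, this amounts to
    subtracting r + lambda2 times the projection P onto one. *)
Lemma dual_psd : psd (l2%:M + A + ((r%:R - l2) / nu) *: (sgn^T *m sgn) -
  ((r%:R + l2) / nu) *: (one^T *m one)).
Proof.
set M := _ + _ *: (sgn^T *m sgn).
have Ms : M^T = M := sgn_deflation_psd.1.
pose P := nu^-1 *: (one^T *m one).
have nu0 : nu != 0 by rewrite gt_eqF // nu_gt0.
have Ps : P^T = P by rewrite /P linearZ /= trmx_mul trmxK.
have oneP : one *m P = one.
  by rewrite /P -scalemxAr mulmxA one_norm mul_scalar_mx scalerA mulVf // scale1r.
have PP : P *m P = P by rewrite {1}/P -scalemxAl -mulmxA oneP.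
have oneM : one *m M = (r%:R + l2) *: one.
  rewrite /M !mulmxDr mul_mx_scalar one_adjacency -scalemxAr mulmxA one_sgn.
  by rewrite mul0mx scaler0 addr0 -scalerDl addrC.
have PM : P *m M = (r%:R + l2) *: P.
  by rewrite /P -scalemxAl -mulmxA oneM -scalemxAr !scalerA mulrC.
have MP : M *m P = (r%:R + l2) *: P by rewrite -Ms -Ps -trmx_mul PM linearZ.
have := psd_conj (1%:M - P) sgn_deflation_psd; rewrite -/M.
rewrite [(1%:M - P)^T]linearB /= trmx1 Ps mulmxBl mul1mx mulmxBr mulmx1.
by rewrite mulmxBl PM MP -scalemxAl PP subrr subr0 /P scalerA.
Qed.

Lemma edge_free_ineq (X : 'M[R]_N) : psd X -> zero_on_edges e X ->
  (r%:R + l2) * (one *m X *m one^T) 0 0 <=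
  2 * n%:R * l2 * \tr X + (r%:R - l2) * (sgn *m X *m sgn^T) 0 0.
Proof.
move=> Xp X0; have := mxtrace_psd_ge0 dual_psd Xp.
have trAX : \tr (A *m X) = 0.
  rewrite /mxtrace big1 // => i _; rewrite mxE big1 // => j _; rewrite mxE.
  have [eij|_] := boolP (e _ _); last by rewrite mul0r.
  by rewrite (X0 j i) ?mulr0 // e_sym.
rewrite mulmxBl !mulmxDl mul_scalar_mx -!scalemxAl raddfB /= !mxtraceD !mxtraceZ.
rewrite trAX addr0 !mxtrace_row_mul -nuE.
have := nu_gt0; set a := (one *m X *m one^T) 0 0; set b := (sgn *m X *m _) 0 0.
move=> nu0; rewrite -(pmulr_rge0 _ nu0) => h; rewrite -subr_ge0.
apply: le_trans h _; rewrite le_eqVlt; apply/orP; left; apply/eqP.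
by field; rewrite gt_eqF.
Qed.

(** Any choice of p and q in the quadratic inequality of the bordered matrix
    gives a bound on the term linear in the trace; q = -1 and the p below are
    those for which equality holds at the optimal X. *)
Lemma g1_le_ghat : g1 R e V1 V2 <= ghat n r l2.
Proof.
have [X [Xb X0] [<- _]] := g1_attained R e V1 V2.
have Xp : psd X.
  have := psd_conj (col_mx 0 1%:M : 'M[R]_(1 + N, N)) Xb.
  rewrite tr_col_mx /bordered mul_row_block mul_row_col trmx1 trmx0.
  by rewrite !mul0mx !mul1mx !mulmx0 mulmx1 !add0r.
have := edge_free_ineq Xp X0; rewrite objective_inner.
have quad p q := bordered_quadratic p q Xb.
have := Xp.2 sgn; move: quad.
set a := (one *m X *m _) 0 0; set b := (sgn *m X *m _) 0 0; set t := \tr X.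
move=> quad b0 ineq.
have l0 := lambda2_ge0; have r0 := r_gt0; have n0 := n_gt0.
rewrite /ghat; case: ifPn => [rl|]; last rewrite -ltNge => rl.
  pose k := l2 / (r%:R + l2).
  (* The case distinction: r <= 3 lambda2 makes the coefficient 1 - 4 k of b
     nonpositive in the final estimate, so that b can be dropped. *)
  have k4 : 1 <= 4 * k by rewrite /k mulrA ler_pdivlMr; lra.
  have := quad (2 * n%:R * k) (-1).
  have -> : n%:R ^+ 2 * l2 ^+ 2 / (l2 + r%:R) ^+ 2 = n%:R ^+ 2 * k ^+ 2 :> R.
    by rewrite /k; field; lra.
  have : a <= 2 * n%:R * k * t + (1 - 2 * k) * b.
    rewrite -(ler_pM2l (_ : 0 < r%:R + l2)); last by lra.
    apply: le_trans ineq _; rewrite le_eqVlt; apply/orP; left; apply/eqP.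
    by rewrite /k; field; lra.
  by nra.
(* The linear inequality, scaled so that b has the same coefficient as in the
   objective, cancels b. *)
pose m := l2 / (r%:R - l2).
have m0 : 0 <= m by rewrite divr_ge0 //; lra.
have := quad (n%:R / 2) (-1).
have -> : n%:R ^+ 2 * l2 / (8 * (r%:R - l2)) = n%:R ^+ 2 * m / 8 :> R.
  by rewrite /m; field; lra.
have : (1 + 2 * m) * a <= 2 * n%:R * m * t + b.
  rewrite -(ler_pM2l (_ : 0 < r%:R - l2)); last by lra.
  apply: le_trans (le_trans _ ineq) _; rewrite le_eqVlt; apply/orP; left;
    apply/eqP.
    by rewrite /m; field; lra.
  by rewrite /m; field; lra.
by move=> h1 h2; nra.
Qed.

Lemma h1_le_hhat (e_irr : irreflexive e) : h1 R e V1 V2 <= hhat n r l2.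
Proof.
have [X [Xp Xt X0] [<- _]] := h1_attained R V1 V2 e_irr (ltnW N_gt1).
have := edge_free_ineq Xp X0; rewrite objective_inner Xt.
have := Xp.2 sgn.
set a := (one *m X *m _) 0 0; set b := (sgn *m X *m _) 0 0.
have l0 := lambda2_ge0; have r0 := r_gt0; have n0 := n_gt0.
move=> b0 ineq.
rewrite /hhat ler_pdivlMr; last by lra.
by nra.
Qed.

(** * Lower bounds *)

Definition rank_perm (s : {perm T}) : 'I_N -> 'I_N :=
  fun i => enum_rank (s (enum_val i)).

Lemma rank_perm_inj s : injective (rank_perm s).
Proof. by move=> i j /enum_rank_inj/perm_inj/enum_val_inj. Qed.

Lemma automorphism_commute (s : {perm T}) : s \in automorphisms e ->
  comm_mx (perm_mx (perm (@rank_perm_inj s))) A.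
Proof.
rewrite inE => /'forall_'forall_eqP es.
rewrite /comm_mx -row_permE -[X in _ *m perm_mx X]invgK -col_permE.
apply/matrixP => i j; rewrite !mxE permE.
set p := perm _; have [k ->] : exists k, j = p k.
  by exists (p^-1%g j); rewrite permKV.
by rewrite permK permE !enum_rankK es.
Qed.

Lemma commute_invariant (K : 'M[R]_N) : (forall S, comm_mx S A -> comm_mx S K) ->
  forall s, s \in automorphisms e -> forall x y,
  K (enum_rank (s x)) (enum_rank (s y)) = K (enum_rank x) (enum_rank y).
Proof.
move=> KA s /automorphism_commute/KA.
rewrite /comm_mx -row_permE -[X in _ *m perm_mx X]invgK -col_permE.
set p := perm _ => /matrixP sK x y.
have := sK (enum_rank x) (p (enum_rank y)).
by rewrite !mxE permK !permE /rank_perm !enum_rankK.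
Qed.

(** Double counting fixes the constants: tr (A F) = lambda2 tr F is the common
    value of F on edges times the number 2nr of ordered pairs of adjacent
    vertices, and tr F is 2n times the common diagonal entry. *)
Lemma flipped_eigenprojection : edge_transitive e -> exists f : 'M[R]_N,
  [/\ psd f, \tr f = 1, one *m f = 0, sgn *m f = 0 &
      (forall i j, e (enum_val i) (enum_val j) -> f i j = - (l2 / (r%:R * nu))) /\
      (vertex_transitive e -> forall i, f i i = nu^-1)].
Proof.
move=> etr.
have [F [c [Fp AF oneF trF Fc]]] :=
  second_eigenprojection adjacency_sym one_neq0 one_adjacency adjacency_le N_gt1.
have Finv s (sA : s \in automorphisms e) x y :
    F (enum_rank (s x)) (enum_rank (s y)) = F (enum_rank x) (enum_rank y).
  have oo i j : (c *: (one^T *m one)) i j = c.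
    by rewrite mxE mxE big_ord1 !mxE !mulr1.
  have := commute_invariant Fc sA x y.
  by rewrite mxE [X in _ = X -> _]mxE !oo => /addIr.
have Fsym i j : F i j = F j i by rewrite -[in LHS]Fp.1 mxE.
have nu0 := nu_gt0; have r0 := r_gt0.
have sgnF : sgn *m F = 0.
  apply: eigenvectors_orthogonal sgn_adjacency AF _.
  by rewrite lt_eqF // (lt_le_trans _ lambda2_ge0) // oppr_lt0.
have [k Fedge] : exists k, forall i j, e (enum_val i) (enum_val j) -> F i j = k.
  pose x0 : T := enum_val (Ordinal (ltnW N_gt1)).
  have [y0 xy0] : exists y0, e x0 y0.
    have /card_gt0P[y] : (0 < #|[set y | e x0 y]%SET|)%N by rewrite e_reg.
    by rewrite inE => xy; exists y.
  exists (F (enum_rank x0) (enum_rank y0)) => i j eij.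
  have inE2 x y : e x y -> [set x; y]%SET \in edges e.
    by move=> exy; apply/imsetP; exists (x, y); rewrite ?inE.
  have := inE2 _ _ eij; rewrite -(atransP etr _ (inE2 _ _ xy0)).
  move=> /orbitP[s sA]; rewrite /= /setact imsetU1 imset_set1 /= !apermE => st.
  have eirr : enum_val i != enum_val j.
    apply/eqP => /enum_val_inj ij.
    have sij : sgn 0 i = - sgn 0 j by apply: sgn_edge; rewrite mxE eij oner_neq0.
    by have := sgn_sqr i; rewrite {1}sij -ij mulNr sgn_sqr; lra.
  have iS : enum_val i \in [set s x0; s y0]%SET by rewrite st !inE eqxx.
  have jS : enum_val j \in [set s x0; s y0]%SET by rewrite st !inE eqxx orbT.
  (* An edge is an unordered pair: s may exchange its ends, which the symmetry
     of F absorbs. *)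
  have := Finv s sA x0 y0; rewrite -[i]enum_valK -[j]enum_valK.
  move: iS jS eirr; rewrite !inE => /orP[]/eqP -> /orP[]/eqP -> //;
    rewrite ?eqxx //.
  by rewrite Fsym.
have trAF : \tr (A *m F) = k * (r%:R * nu).
  have -> : \tr (A *m F) = k * \sum_j \sum_i A i j.
    rewrite exchange_big mulr_sumr; apply: eq_bigr => i _.
    rewrite mxE mulr_sumr; apply: eq_bigr => j _; rewrite mxE.
    have [eij|_] := boolP (e _ _); last by rewrite mul0r mulr0.
    by rewrite (Fedge j i) ?mul1r ?mulr1 // e_sym.
  congr (_ * _); rewrite (eq_bigr (fun=> r%:R)) => [|j _].
    by rewrite sumr_const card_ord mulr_natr.
  have /rowP/(_ j) := one_adjacency; rewrite !mxE mulr1 => <-.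
  by apply: eq_bigr => i _; rewrite !mxE mul1r.
have kE : k = l2 * \tr F / (r%:R * nu).
  by rewrite -[l2 * _]mxtraceZ -AF trAF mulfK // mulf_neq0 // gt_eqF.
exists ((\tr F)^-1 *: (D *m F *m D)); split.
- apply: psdZ; first by rewrite invr_ge0 ltW.
  by have := psd_conj D Fp; rewrite tr_diag_mx.
- by rewrite mxtraceZ mxtrace_mulC mulmxA diag_diag mul1mx mulVf // gt_eqF.
- by rewrite -scalemxAr !mulmxA one_diag sgnF mul0mx scaler0.
- by rewrite -scalemxAr !mulmxA sgn_diag oneF mul0mx scaler0.
have fE i j : ((\tr F)^-1 *: (D *m F *m D)) i j =
    (\tr F)^-1 * (sgn 0 i * F i j * sgn 0 j).
  by rewrite mxE mul_mx_diag mxE mul_diag_mx mxE.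
split=> [i j eij|vtr i]; rewrite fE.
  have -> : sgn 0 i = - sgn 0 j by apply: sgn_edge; rewrite mxE eij oner_neq0.
  rewrite (Fedge _ _ eij) mulNr mulNr mulrAC sgn_sqr kE mul1r.
  by field; rewrite !gt_eqF.
rewrite mulrAC sgn_sqr mul1r.
have trFi : \tr F = nu * F i i.
  rewrite /mxtrace (eq_bigr (fun=> F i i)) => [|j _].
    by rewrite sumr_const card_ord mulr_natl.
  have : enum_val j \in [set: T]%SET by rewrite inE.
  rewrite -(atransP vtr _ (finset.in_setT (enum_val i))) => /orbitP[s sA].
  rewrite /= apermE => sij.
  by have := Finv s sA (enum_val i) (enum_val i); rewrite sij !enum_valK.
have Fi0 : F i i != 0.
  by apply: contraTneq trF => Fi0; rewrite trFi Fi0 mulr0 ltxx.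
by rewrite trFi; field; rewrite Fi0 gt_eqF.
Qed.

Lemma one_quadratic_form (a b c : R) (f : 'M[R]_N) : one *m f = 0 ->
  (one *m (a *: (one^T *m one) + (b *: f + c *: (sgn^T *m sgn))) *m one^T) 0 0 =
  a * nu ^+ 2.
Proof.
move=> onef; rewrite !mulmxDr -!scalemxAr onef !mulmxA one_norm one_sgn.
rewrite mul0mx !scaler0 !addr0 mul_scalar_mx -!scalemxAl one_norm.
by rewrite 2!mxE mxE eqxx mulr1n expr2.
Qed.

Lemma sgn_quadratic_form (a b c : R) (f : 'M[R]_N) : sgn *m f = 0 ->
  (sgn *m (a *: (one^T *m one) + (b *: f + c *: (sgn^T *m sgn))) *m sgn^T) 0 0 =
  c * nu ^+ 2.
Proof.
have sgn_one : sgn *m one^T = 0.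
  by rewrite -[LHS]trmxK trmx_mul trmxK one_sgn trmx0.
move=> sgnf; rewrite !mulmxDr -!scalemxAr sgnf !mulmxA sgn_norm sgn_one.
rewrite mul0mx !scaler0 !add0r mul_scalar_mx -!scalemxAl sgn_norm.
by rewrite 2!mxE mxE eqxx mulr1n expr2.
Qed.

(** X = a J + b f + c S has constant diagonal x = a + b / 2n + c, so its bordered
    matrix is positive semidefinite when a = x^2 and b, c >= 0; it vanishes on
    edges when a = b lambda2 / 2nr + c; its objective value is n^2 (a - c).
    With c = 0 the nonzero solution has x = lambda2 / (r + lambda2).  When
    lambda2 < r, the equations give in general
      a - c = (x - 2 x^2) lambda2 / (r - lambda2),
    which is largest at x = 1/4; the corresponding c is nonnegative exactly when
    r >= 3 lambda2. *)
Lemma ghat_le_g1 : vertex_transitive e -> edge_transitive e ->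
  ghat n r l2 <= g1 R e V1 V2.
Proof.
move=> vtr /flipped_eigenprojection[f [fp trf onef sgnf [fedge /(_ vtr) fdiag]]].
have attained a b c :
   0 <= b -> 0 <= c -> a - b * (l2 / (r%:R * nu)) - c = 0 ->
   a = (a + b / nu + c) ^+ 2 -> nu ^+ 2 * (a - c) / 4 <= g1 R e V1 V2.
  move=> b0 c0 abc aE.
  pose X := a *: (one^T *m one) + (b *: f + c *: (sgn^T *m sgn)).
  have XE i j : X i j = a + (b * f i j + c * (sgn 0 i * sgn 0 j)).
    have DE (M1 M2 : 'M[R]_N) : (M1 + M2) i j = M1 i j + M2 i j by rewrite mxE.
    have ZE d (M : 'M[R]_N) : (d *: M) i j = d * M i j by rewrite mxE.
    have SE (v : 'rV[R]_N) : (v^T *m v) i j = v 0 i * v 0 j.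
      by rewrite mxE big_ord1 mxE.
    by rewrite /X !DE !ZE !SE [one _ _]mxE [one _ j]mxE !mulr1.
  have [_ _ [_ gmax]] := g1_attained R e V1 V2.
  have := gmax X; rewrite objective_inner.
  rewrite /X one_quadratic_form // sgn_quadratic_form // => h.
  apply: le_trans (h _); first by lra.
  split; last first.
    move=> i j eij; rewrite XE fedge //.
    have -> : sgn 0 i = - sgn 0 j by apply: sgn_edge; rewrite mxE eij oner_neq0.
    by rewrite mulNr sgn_sqr; lra.
  apply: (@psd_bordered _ _ (a + b / nu + c) X (b *: f + c *: (sgn^T *m sgn))).
  - by move=> i; rewrite XE fdiag sgn_sqr mulr1 addrA.
  - by apply: psdD; apply: psdZ => //; exact: psd_sqr.
  - by rewrite -aE.
have l0 := lambda2_ge0; have r0 := r_gt0; have n0 := n_gt0; have nu0 := nu_gt0.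
rewrite /ghat; case: ifPn => [rl|]; last rewrite -ltNge => rl.
  have l0' : 0 < l2 by lra.
  pose k := l2 / (r%:R + l2).
  have := attained (k ^+ 2) (k ^+ 2 * (r%:R * nu) / l2) 0.
  have -> : n%:R ^+ 2 * l2 ^+ 2 / (l2 + r%:R) ^+ 2 =
      nu ^+ 2 * (k ^+ 2 - 0) / 4 :> R.
    by rewrite nuE /k; field; lra.
  apply=> //.
  - by rewrite divr_ge0 // mulr_ge0 ?sqr_ge0 // mulr_ge0 // ltW.
  - by field; rewrite !gt_eqF.
  - by rewrite /k; field; rewrite !gt_eqF //; lra.
pose c : R := 16^-1 - l2 / (8 * (r%:R - l2)).
have := attained 16^-1 (nu * r%:R / (8 * (r%:R - l2))) c.
have -> : n%:R ^+ 2 * l2 / (8 * (r%:R - l2)) = nu ^+ 2 * (16^-1 - c) / 4 :> R.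
  by rewrite nuE /c; field; lra.
apply.
- by rewrite divr_ge0 ?mulr_ge0 ?ltW //; lra.
- by rewrite /c subr_ge0 ler_pdivrMr; lra.
- by rewrite /c; field; rewrite !gt_eqF //; lra.
- by rewrite /c; field; rewrite !gt_eqF //; lra.
Qed.

(** Take a J + b f with the two coefficients determined by trace 1 and by
    vanishing on edges. *)
Lemma hhat_le_h1 : irreflexive e -> edge_transitive e ->
  hhat n r l2 <= h1 R e V1 V2.
Proof.
move=> e_irr /flipped_eigenprojection[f [fp trf onef sgnf [fedge _]]].
have l0 := lambda2_ge0; have r0 := r_gt0; have n0 := n_gt0; have nu0 := nu_gt0.
pose a := l2 / ((r%:R + l2) * nu); pose b := r%:R / (r%:R + l2).
have b0 : 0 <= b by rewrite /b divr_ge0 //; lra.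
have a0 : 0 <= a by rewrite /a divr_ge0 // mulr_ge0 //; lra.
pose X := a *: (one^T *m one) + (b *: f + 0 *: (sgn^T *m sgn)).
have [_ _ [_ hmax]] := h1_attained R V1 V2 e_irr (ltnW N_gt1).
have := hmax X; rewrite objective_inner /X.
rewrite one_quadratic_form // sgn_quadratic_form //.
rewrite mul0r subr0 scale0r addr0.
have -> : 4^-1 * (a * nu ^+ 2) = hhat n r l2.
  by rewrite /hhat /a nuE; field; lra.
apply; split.
- by apply: psdD; apply: psdZ => //; exact: psd_sqr.
- rewrite mxtraceD !mxtraceZ trf mxtrace_mulC one_norm mxtrace_scalar mulr1n.
  by rewrite /a /b; field; lra.
- move=> i j eij; rewrite mxE [X in X + _]mxE [X in _ + X]mxE fedge //.
  rewrite mxE big_ord1 !mxE /a /b.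
  by field; rewrite !gt_eqF //; lra.
Qed.

End RegularBipartite.

Theorem proposition1p3 (R : realType) (T : finType) (e : rel T)
    (V1 V2 : {set T}) (r n : nat)
    (e_sym : symmetric e) (e_irr : irreflexive e)
    (e_bip : bipartition e V1 V2)
    (e_reg : regular e r) (r_ge1 : (1 <= r)%N)
    (cardV1 : #|V1| = n) (cardV2 : #|V2| = n) (n_ge2 : (2 <= n)%N) :
  let l2 : R := lambda2 (adjacency R e) in
  [/\ g1 R e V1 V2 <= ghat n r l2,
      h1 R e V1 V2 <= hhat n r l2,
      vertex_transitive e -> edge_transitive e -> g1 R e V1 V2 = ghat n r l2 &
      edge_transitive e -> h1 R e V1 V2 = hhat n r l2].
Proof.
move=> l2.
have g_le : g1 R e V1 V2 <= ghat n r l2.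
  exact: (g1_le_ghat R e_sym e_bip e_reg r_ge1 cardV1 cardV2 n_ge2).
have h_le : h1 R e V1 V2 <= hhat n r l2.
  exact: (h1_le_hhat R e_sym e_bip e_reg r_ge1 cardV1 cardV2 n_ge2 e_irr).
split=> // [vtr etr | etr]; apply/eqP; rewrite eq_le ?g_le ?h_le /=.
  exact: (ghat_le_g1 R e_sym e_bip e_reg r_ge1 cardV1 cardV2 n_ge2 vtr etr).
exact: (hhat_le_h1 R e_sym e_bip e_reg r_ge1 cardV1 cardV2 n_ge2 e_irr etr).
Qed.
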